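(* 1) If $n_1,n_2,\ldots,n_k\in\mathbb{N}$ and $2\leq n_1\leq n_2\leq\cdots\leq n_k$, then $$W(T(2n_1,2n_2,\ldots,2n_k))\geq k+\sum_{i=1}^{k}n_i(2i-1).$$ 2) If $m_1,m_2,\ldots,m_k,n_1,n_2,\ldots,n_{k+s}\in\mathbb{N}$ ($s\geq 0$), $1\leq m_1\leq m_2\leq\cdots\leq m_k$ and $2\leq n_1\leq n_2\leq\cdots\leq n_{k+s}$, then $$W(T(2n_1,\ldots,2n_{k+s},2m_1+1,\ldots,2m_k+1))\geq s+2k^2+2\sum_{i=1}^{k}(m_i+n_i)+\sum_{j=1}^{s}n_{k+j}(4k+2j-1).$$
   Context: All graphs are finite, undirected, without loops or multiple edges. An interval $t$-coloring of a graph $G$ ($t$ a positive integer) is a proper edge-coloring of $G$ with colors $1,\ldots,t$ such that all colors are used and, for each vertex $v$, the set of colors of the edges incident to $v$ is an interval of integers. $G$ is interval colorable if it has an interval $t$-coloring for some positive integer $t$; then $W(G)$ denotes the maximum such $t$. The $d$-dimensional torus $T(l_1,\ldots,l_d)$ ($l_i\ge 3$) is the Cartesian product of cycles $C_{l_1}\square C_{l_2}\square\cdots\square C_{l_d}$, where $C_l$ is the cycle on $l$ vertices. (It is known that $T(l_1,\ldots,l_d)$ is interval colorable whenever $l_1\cdots l_d$ is even.) *)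

(* Defs.v *)
From mathcomp Require Import all_boot.
From mathcomp Require Import boolp.

Set Implicit Arguments.
Unset Strict Implicit.
Unset Printing Implicit Defensive.

Record sgraph := SGraph {
  vertex :> finType;
  adj : rel vertex;
  adj_sym : symmetric adj;
  adj_irrefl : irreflexive adj }.

Definition edges (G : sgraph) : {set {set G}} :=
  [set [set p.1; p.2] | p : G * G & adj p.1 p.2].

Definition proper_edge_coloring (G : sgraph) (c : {set G} -> nat) : Prop :=
  forall e f, e \in edges G -> f \in edges G -> e != f -> e :&: f != set0 ->
    c e <> c f.

Definition interval_coloring (G : sgraph) (t : nat) (c : {set G} -> nat) : Prop :=
  [/\ proper_edge_coloring c,
      forall e, e \in edges G -> 1 <= c e <= t,
      forall i, 1 <= i <= t -> exists2 e, e \in edges G & c e = i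
    & forall v : G, exists a b, forall i,
        (exists e, [/\ e \in edges G, v \in e & c e = i]) <-> a <= i <= b].

Definition interval_t_colorable (G : sgraph) (t : nat) : Prop :=
  0 < t /\ exists c, @interval_coloring G t c.

Definition interval_colorable (G : sgraph) : Prop :=
  exists t, interval_t_colorable G t.

(* An interval t-coloring uses t colors, so t <= #|edges G| and the maximum may
   be taken over this finite range; see W_spec. W G = 0 if G is not interval
   colorable. *)
Definition W (G : sgraph) : nat :=
  \max_(t < #|edges G|.+1 | `[< interval_t_colorable G t >]) t.

Lemma interval_t_colorable_le (G : sgraph) (t : nat) :
  interval_t_colorable G t -> t <= #|edges G|.
Proof.
case=> _ [c [_ _ used _]].
pose s := [seq c e | e <- enum (edges G)].
have sub : {subset iota 1 t <= s}.
  move=> i; rewrite mem_iota add1n ltnS => /used[e eG <-].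
  by apply: map_f; rewrite mem_enum.
by have := uniq_leq_size (iota_uniq 1 t) sub; rewrite size_iota size_map -cardE.
Qed.

Lemma W_spec (G : sgraph) : interval_colorable G ->
  interval_t_colorable G (W G) /\
  forall t, interval_t_colorable G t -> t <= W G.
Proof.
case=> t0 Gt0; have lt0 := interval_t_colorable_le Gt0; split.
  have t0P : `[< interval_t_colorable G (Ordinal (lt0 : t0 < #|edges G|.+1)) >].
    exact/asboolP.
  by rewrite /W (bigmax_eq_arg _ t0P); case: arg_maxnP => // i /asboolP.
move=> t Gt; have lt := interval_t_colorable_le Gt.
by apply: (bigmax_sup (Ordinal (lt : t < #|edges G|.+1))) => //; apply/asboolP.
Qed.

Section CartesianProduct.
Variables G H : sgraph.

Definition cart_adj : rel (G * H) := fun x y =>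
  (adj x.1 y.1 && (x.2 == y.2)) || ((x.1 == y.1) && adj x.2 y.2).

Lemma cart_adj_sym : symmetric cart_adj.
Proof.
by move=> x y; rewrite /cart_adj adj_sym (eq_sym x.2) (eq_sym x.1) (adj_sym x.2).
Qed.

Lemma cart_adj_irrefl : irreflexive cart_adj.
Proof. by move=> x; rewrite /cart_adj !adj_irrefl andbF. Qed.

Definition cart_prod : sgraph := SGraph cart_adj_sym cart_adj_irrefl.

End CartesianProduct.

(* The condition i != j only matters for l = 1; this is the cycle C_l for
   l >= 3. *)
Definition cycle_adj (l : nat) : rel 'I_l := fun i j =>
  (i != j) && ((i.+1 %% l == j) || (j.+1 %% l == i)).

Lemma cycle_adj_sym l : symmetric (@cycle_adj l).
Proof. by move=> i j; rewrite /cycle_adj eq_sym orbC. Qed.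

Lemma cycle_adj_irrefl l : irreflexive (@cycle_adj l).
Proof. by move=> i; rewrite /cycle_adj eqxx. Qed.

Definition cycle_graph (l : nat) : sgraph :=
  SGraph (@cycle_adj_sym l) (@cycle_adj_irrefl l).

Lemma unit_adj_sym : symmetric (fun _ _ : unit => false).
Proof. by []. Qed.

Lemma unit_adj_irrefl : irreflexive (fun _ _ : unit => false).
Proof. by []. Qed.

Definition one_vertex_graph : sgraph := SGraph unit_adj_sym unit_adj_irrefl.

(* torus [:: l_1; ...; l_d] = (C_(l_1) [] C_(l_2)) [] ... [] C_(l_d); the torus
   T(l_1, ..., l_d) is meant only for d >= 1 and all l_i >= 3. *)
Definition torus (ls : seq nat) : sgraph :=
  if ls is l :: ls' then
    foldl (fun G l' => cart_prod G (cycle_graph l')) (cycle_graph l) ls'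
  else one_vertex_graph.

(* Main.v *)
Require Import Defs.
From mathcomp Require Import all_boot.
From mathcomp Require Import zify.

Set Implicit Arguments.
Unset Strict Implicit.
Unset Printing Implicit Defensive.

(** The bounds come from explicit colorings of Cartesian products of regular
    graphs. Call a coloring of an r-regular graph, with colors 0, ..., t - 1,
    interval if the colors at each vertex v are a v, a v + 1, ..., a v + r - 1
    for some a v. In a product G [] H every copy of G can carry the same
    coloring of G, shifted by an amount s u that depends on the vertex u of H;
    an edge of H in the copy of H at x gets a color a x + c. At (x, u) everything
    is then a translate by a x of a picture that depends on u only: a block of r
    consecutive colors starting at s u, and the numbers c of the edges at u. It
    suffices that these together are an interval ([layered_colorable]).

    Two choices of the shifts give two recursive bounds.
    - On an even cycle C_2n, let the copies of G climb by r + 1 per step along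
      both halves of the cycle, one half being one color higher than the other.
      Each cycle edge fills the gap between consecutive copies, and n (r + 1) + 1
      new colors appear ([even_cycle_colorable]).
    - On any q-regular H with an interval coloring of more than q colors, keep
      that coloring on the edges of H, put the copy of G below the colors of H
      at one vertex which sees the smallest color, and above them at all other
      vertices. This gives W(G) + W(H) + r colors ([cart_colorable_add]).

    An odd cycle has no interval coloring, so it is treated together with an
    even one. Color the edges of C_(2m+1) by 1, 3, ..., 2m+1, 2m, ..., 4, 2 in
    cyclic order. Two consecutive edges differ by 2 or 1, so one further color
    completes each vertex to an interval of three, and the intervals together
    cover 0, ..., 2m+2. In C_(2m+1) [] C_2n the copies of C_(2m+1) are grouped
    in n pairs of adjacent copies with the same coloring; the edges inside a
    pair take the completing colors, and consecutive pairs are at distance 4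
    while climbing, so that the edges between pairs fill the gaps
    ([paired_cycle_colorable]). This uses at least 2m + 2n + 2 colors.

    The first bound follows by adding the even cycles one at a time to a single
    vertex. For the second, the k products C_(2 n_i) [] C_(2 m_i + 1) are
    multiplied together, the sum of the terms r = 4 (i - 1) and of the k terms 2
    being 2 k^2, and then the remaining s even cycles are added one at a time.
    The order of the factors does not matter up to isomorphism. *)

(** * Colorings of regular graphs by palettes *)

Definition palette (G : sgraph) (f : G -> G -> nat) (v : G) : seq nat :=
  [seq f v w | w <- enum (adj v)].

(** The intervals [a x, a x + r) fill [0, t). The first clause makes X
    inhabited also for t = 0, the case of the one-vertex graph. *)
Definition covers (X : Type) (a : X -> nat) (r t : nat) : Prop :=
  [/\ exists x, a x = 0,
      forall x, a x + r <= t
    & forall i, i < t -> exists x, a x <= i < a x + r].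

(** An interval coloring of an r-regular graph, with colors 0, ..., t - 1, given
    as a function of the two ends of an edge. Comparing the list of colors at a
    vertex with an interval up to permutation expresses at once properness,
    regularity and the interval condition. *)
Definition colorable (G : sgraph) (r t : nat) : Prop :=
  exists (f : G -> G -> nat) (a : G -> nat),
    [/\ forall u v, adj u v -> f u v = f v u,
        forall v, perm_eq (palette f v) (iota (a v) r)
      & covers a r t].

Lemma edgesP (G : sgraph) (e : {set G}) :
  reflect (exists u v, adj u v /\ e = [set u; v]) (e \in edges G).
Proof.
apply: (iffP imsetP) => [[[u v] /= uv ->]|[u [v [uv ->]]]]; last first.
  by exists (u, v) => //; rewrite inE.
by move: uv; rewrite inE => uv; exists u, v.
Qed.

Lemma mem_neighbors (G : sgraph) (v w : G) : (w \in enum (adj v)) = adj v w.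
Proof. exact: mem_enum. Qed.

Lemma perm_palette (G : sgraph) (f : G -> G -> nat) v s :
  uniq s -> s =i adj v -> perm_eq (palette f v) [seq f v w | w <- s].
Proof.
move=> us sv; apply/perm_map/uniq_perm => //; first exact: enum_uniq.
by move=> w; rewrite mem_enum sv.
Qed.

(** Colors are 1-based here, and 0-based for functions of two vertices. *)
Definition edge_color (G : sgraph) (f : G -> G -> nat) (e : {set G}) : nat :=
  if [pick p : G * G | adj p.1 p.2 && (e == [set p.1; p.2])] is Some p
  then (f p.1 p.2).+1 else 0.

Lemma edge_colorE (G : sgraph) (f : G -> G -> nat) u v :
  (forall x y, adj x y -> f x y = f y x) -> adj u v ->
  edge_color f [set u; v] = (f u v).+1.
Proof.
move=> fC uv; rewrite /edge_color; case: pickP => [[x y]|/(_ (u, v))]; last first.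
  by rewrite /= uv eqxx.
case/andP=> /= xy /eqP E.
have nuv : u != v by apply: contraTneq uv => ->; rewrite adj_irrefl.
have := set21 u v; have := set22 u v; rewrite E !inE => vxy uxy.
case/orP: uxy => /eqP ux; case/orP: vxy => /eqP vx; subst=> //.
- by rewrite eqxx in nuv.
- by rewrite fC.
by rewrite eqxx in nuv.
Qed.

Lemma mem_palette (G : sgraph) (f : G -> G -> nat) v i :
  reflect (exists2 w, adj v w & i = f v w) (i \in palette f v).
Proof.
by apply: (iffP mapP) => -[w vw ->]; exists w; rewrite ?mem_enum // in vw *.
Qed.

Lemma colorable_le_W (G : sgraph) r t : 0 < t -> colorable G r t -> t <= W G.
Proof.
move=> t0 [f [a [fC pal [_ at_le cov]]]].
have inpal v i : (i \in palette f v) = (a v <= i < a v + r).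
  by rewrite (perm_mem (pal v)) mem_iota.
have at_v v i : (exists e, [/\ e \in edges G, v \in e & edge_color f e = i])
              <-> exists2 w, adj v w & i = (f v w).+1.
  split=> [[e [/edgesP[x [y [xy ->]]]]]|[w vw ->]]; last first.
    exists [set v; w]; split; last exact: edge_colorE.
      by apply/edgesP; exists v, w.
    exact: set21.
  rewrite !inE => /orP[] /eqP-> <-; first by exists y; rewrite ?edge_colorE.
  by exists x; rewrite 1?adj_sym // edge_colorE // fC.
suff Gt : interval_t_colorable G t.
  by have [_] := W_spec (ex_intro _ t Gt); apply.
split=> //; exists (edge_color f); split.
- have star e v : e \in edges G -> v \in e -> exists2 w, adj v w & e = [set v; w].
    case/edgesP=> x [y [xy ->]]; rewrite !inE => /orP[] /eqP->; first by exists y.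
    by exists x; rewrite 1?adj_sym // setUC.
  move=> e e' eG e'G ne /set0Pn[v]; rewrite inE => /andP[/(star _ _ eG)[w vw Ee]].
  case/(star _ _ e'G)=> w' vw' Ee'; rewrite Ee Ee' !edge_colorE // => -[Eff].
  have /dinjectiveP inj : dinjectiveb (f v) (adj v).
    by rewrite /dinjectiveb (perm_uniq (pal v)) iota_uniq.
  by case/eqP: ne; rewrite Ee Ee' (inj w w').
- move=> e /edgesP[u [v [uv ->]]]; rewrite edge_colorE //=.
  have : f u v \in palette f u by apply/mem_palette; exists v.
  by rewrite inpal => /andP[_ /leq_trans]; apply.
- case=> // i /cov[v]; rewrite -inpal => /mem_palette[w vw ->].
  by exists [set v; w]; rewrite ?edge_colorE //; apply/edgesP; exists v, w.
move=> v; exists (a v).+1, (a v + r) => i; rewrite at_v; split.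
  by case=> w vw ->; rewrite ltnS -inpal; apply/mem_palette; exists w.
case: i => // i; rewrite ltnS -inpal => /mem_palette[w vw ->].
by exists w.
Qed.

(** * Isomorphisms and the order of the factors of a torus *)

Definition graph_iso (G H : sgraph) : Prop :=
  exists2 g : G -> H, bijective g & forall x y, adj (g x) (g y) = adj x y.

Lemma graph_iso_refl G : graph_iso G G.
Proof. by exists id => //; exists id. Qed.

Lemma graph_iso_trans G H K : graph_iso G H -> graph_iso H K -> graph_iso G K.
Proof.
move=> [g bg ag] [h bh ah]; exists (h \o g); first exact: bij_comp.
by move=> x y /=; rewrite ah ag.
Qed.

Lemma graph_iso_sym G H : graph_iso G H -> graph_iso H G.
Proof.
move=> [g [h gK hK] ag]; exists h; first by exists g.
by move=> x y; rewrite -ag !hK.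
Qed.

Lemma graph_iso_cart G G' H H' : graph_iso G G' -> graph_iso H H' ->
  graph_iso (cart_prod G H) (cart_prod G' H').
Proof.
move=> [g [g' gK g'K] ag] [h [h' hK h'K] ah].
exists (fun p : G * H => (g p.1, h p.2) : cart_prod G' H').
  exists (fun p : G' * H' => (g' p.1, h' p.2)) => -[x u] /=;
  by rewrite ?gK ?g'K ?hK ?h'K.
move=> [x u] [y w]; rewrite /= /cart_adj /= ag ah.
by rewrite (can_eq gK) (can_eq hK).
Qed.

Lemma graph_iso_cartC G H : graph_iso (cart_prod G H) (cart_prod H G).
Proof.
exists (fun p : G * H => (p.2, p.1) : cart_prod H G).
  by exists (fun p : H * G => (p.2, p.1)) => -[].
by move=> [x u] [y w]; rewrite /= /cart_adj /= orbC andbC [X in _ || X]andbC.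
Qed.

Lemma graph_iso_cartA G H K :
  graph_iso (cart_prod G (cart_prod H K)) (cart_prod (cart_prod G H) K).
Proof.
exists (fun p : G * (H * K) => ((p.1, p.2.1), p.2.2) : cart_prod (cart_prod G H) K).
  by exists (fun p : G * H * K => (p.1.1, (p.1.2, p.2))) => [[x [y z]]|[[x y] z]].
move=> [x [y z]] [x' [y' z']]; rewrite /= /cart_adj /= !xpair_eqE.
rewrite /cart_adj /= andb_orl andb_orr -!andbA -orbA; congr (_ || (_ || _)).
Qed.

Lemma graph_iso_cart1 G : graph_iso G (cart_prod G one_vertex_graph).
Proof.
exists (fun x : G => (x, tt) : cart_prod G one_vertex_graph).
  by exists fst => // -[x []].
by move=> x y; rewrite /= /cart_adj /= andbT andbF orbF.
Qed.

Lemma graph_iso_colorable G H r t :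
  graph_iso G H -> colorable G r t -> colorable H r t.
Proof.
move=> [g [h gK hK] ag] [f [a [fC pal [[x0 ax0] at_le cov]]]].
have ah x y : adj (h x) (h y) = adj x y by rewrite -ag !hK.
exists (fun u v => f (h u) (h v)), (a \o h); split.
- by move=> u v uv; rewrite fC ?ah.
- move=> v /=; apply: perm_trans (pal (h v)).
  rewrite /palette (map_comp (f (h v)) h); apply/perm_map/uniq_perm.
  + by rewrite map_inj_uniq ?enum_uniq //; apply: can_inj hK.
  + exact: enum_uniq.
  move=> x; rewrite mem_neighbors; apply/mapP/idP => [[w]|].
    by rewrite mem_neighbors => vw ->; rewrite ah.
  by move=> vx; exists (g x); rewrite ?gK // mem_neighbors -ah gK.
split; first by exists (g x0); rewrite /= gK.
  by move=> x; apply: at_le.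
by move=> i /cov[x]; exists (g x); rewrite /= gK.
Qed.

(** The torus with an initial one-vertex factor, which makes the empty product
    a starting point for inductions. *)
Definition cycle_product (ls : seq nat) : sgraph :=
  foldl (fun G l => cart_prod G (cycle_graph l)) one_vertex_graph ls.

Lemma cycle_product_rcons ls l :
  cycle_product (rcons ls l) = cart_prod (cycle_product ls) (cycle_graph l).
Proof. by rewrite /cycle_product foldl_rcons. Qed.

Lemma cycle_product1 l : graph_iso (cycle_graph l) (cycle_product [:: l]).
Proof. exact: graph_iso_trans (graph_iso_cart1 _) (graph_iso_cartC _ _). Qed.

Lemma torus_iso ls : graph_iso (cycle_product ls) (torus ls).
Proof.
case: ls => [|l ls]; first exact: graph_iso_refl.
rewrite /cycle_product /=; elim/last_ind: ls => [|ls l' IH] /=.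
  exact/graph_iso_sym/cycle_product1.
rewrite !foldl_rcons; apply: graph_iso_cart => //; exact: graph_iso_refl.
Qed.

Lemma cycle_product_cat ls ls' :
  graph_iso (cycle_product (ls ++ ls'))
            (cart_prod (cycle_product ls) (cycle_product ls')).
Proof.
elim/last_ind: ls' => [|ls' l IH]; first by rewrite cats0; apply: graph_iso_cart1.
rewrite -rcons_cat !cycle_product_rcons.
apply: graph_iso_trans (graph_iso_sym (graph_iso_cartA _ _ _)).
by apply: graph_iso_cart => //; apply: graph_iso_refl.
Qed.

Lemma cycle_product_catC ls ls' :
  graph_iso (cycle_product (ls ++ ls')) (cycle_product (ls' ++ ls)).
Proof.
apply: graph_iso_trans (cycle_product_cat _ _) _.
apply: graph_iso_trans (graph_iso_cartC _ _) _.
exact/graph_iso_sym/cycle_product_cat.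
Qed.

Lemma cycle_product_perm ls ls' :
  perm_eq ls ls' -> graph_iso (cycle_product ls) (cycle_product ls').
Proof.
elim: ls ls' => [|l ls IH] ls'.
  by move=> /perm_size/esym/size0nil->; apply: graph_iso_refl.
rewrite perm_sym => /perm_consP[i [u [rot_ls']]].
rewrite perm_sym => /IH{}IH.
have lsu : graph_iso (cycle_product (l :: ls)) (cycle_product (l :: u)).
  rewrite -cat1s -[l :: u]cat1s.
  apply: graph_iso_trans (cycle_product_cat _ _) _.
  apply: graph_iso_trans (graph_iso_sym (cycle_product_cat _ _)).
  by apply: graph_iso_cart => //; apply: graph_iso_refl.
apply: graph_iso_trans lsu _; rewrite -rot_ls' /rot.
apply: graph_iso_trans (cycle_product_catC _ _) _.
by rewrite cat_take_drop; apply: graph_iso_refl.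
Qed.

(** * Colorings of Cartesian products *)

(** The intervals of a sum fill [0, t + T - r): those at a minimum of a fill
    [0, T), and those at a maximum of b fill the rest, because widening the
    intervals [a x, a x + r) to length r + q and moving them up by the maximum
    T - r - q of b reaches from below T up to t + T - r. *)
Lemma covers_add (X Y : Type) (a : X -> nat) (b : Y -> nat) r q t T :
  covers a r t -> covers b (r + q) T ->
  covers (fun p : X * Y => a p.1 + b p.2) (r + q) (t + T - r).
Proof.
move=> [[x0 ax0] at_le cova] [[u0 bu0] bT_le covb]; split.
- by exists (x0, u0); rewrite /= ax0 bu0.
- by move=> [x u] /=; have := at_le x; have := bT_le u; lia.
move=> i it; case: (ltnP i T) => [/covb[u bu]|Ti].
  by exists (x0, u); rewrite /= ax0.
(* u has the largest b u, that is T - (r + q); x is found by translating i. *)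
have rt := at_le x0; have rT := bT_le u0.
have [x ax] : exists x, a x <= i + r - T < a x + r by apply: cova; lia.
have [u bu] : exists u, b u <= T.-1 < b u + (r + q) by apply: covb; lia.
by exists (x, u) => /=; have := bT_le u; lia.
Qed.

(** [g u] colors the copy of G at u, and [h x] the copy of H at x. *)
Definition cart_color (G H : sgraph) (g : H -> G -> G -> nat)
    (h : G -> H -> H -> nat) (p q : cart_prod G H) : nat :=
  if p.2 == q.2 then g p.2 p.1 q.1 else h p.1 p.2 q.2.

Lemma palette_cart (G H : sgraph) (g : H -> G -> G -> nat)
    (h : G -> H -> H -> nat) (x : G) (u : H) :
  perm_eq (palette (cart_color g h) ((x, u) : cart_prod G H))
          (palette (g u) x ++ palette (h x) u).
Proof.
pose s : seq (cart_prod G H) :=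
  [seq (y, u) | y <- enum (adj x)] ++ [seq (x, w) | w <- enum (adj u)].
have -> : palette (g u) x ++ palette (h x) u = [seq cart_color g h (x, u) p | p <- s].
  rewrite map_cat -!map_comp; congr (_ ++ _).
    by apply: eq_map => y; rewrite /= /cart_color /= eqxx.
  apply/eq_in_map => w; rewrite mem_neighbors /cart_color /= => uw.
  by case: eqP uw => // ->; rewrite adj_irrefl.
apply: perm_palette.
  rewrite cat_uniq !map_inj_uniq ?enum_uniq /=; try by move=> ? ? [].
  rewrite andbT; apply/hasPn => _ /mapP[w uw ->]; apply/mapP => -[y xy [xy' _]].
  by rewrite mem_neighbors -xy' adj_irrefl in xy.
move=> [y w]; rewrite mem_cat [RHS]/= /cart_adj /=; congr (_ || _).
  apply/mapP/andP => [[y' xy' [-> ->]]|[xy /eqP->]]; first by rewrite -mem_neighbors.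
  by exists y; rewrite ?mem_neighbors.
apply/mapP/andP => [[w' uw' [-> ->]]|[/eqP-> uw]]; first by rewrite -mem_neighbors.
by exists w; rewrite ?mem_neighbors.
Qed.

Lemma cart_colorable (G H : sgraph) (g : H -> G -> G -> nat)
    (h : G -> H -> H -> nat) (a : G * H -> nat) r t :
  (forall u x y, adj x y -> g u x y = g u y x) ->
  (forall x u w, adj u w -> h x u w = h x w u) ->
  (forall x u, perm_eq (palette (g u) x ++ palette (h x) u) (iota (a (x, u)) r)) ->
  covers a r t -> colorable (cart_prod G H) r t.
Proof.
move=> gC hC pal cov; exists (cart_color g h), a; split=> //; last first.
  by move=> [x u]; apply: perm_trans (palette_cart _ _ _ _) (pal x u).
move=> [x u] [y w]; rewrite /= /cart_adj /cart_color /= (eq_sym w).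
case: eqP => [-> | _]; first by rewrite adj_irrefl andbF orbF andbT; apply: gC.
by rewrite andbF /= => /andP[/eqP-> uw]; apply: hC.
Qed.

Lemma palette_shift (G : sgraph) (f : G -> G -> nat) k v :
  palette (fun u w => k + f u w) v = [seq k + i | i <- palette f v].
Proof. by rewrite /palette -map_comp. Qed.

(** At (x, u) the copy of G has the colors a x + s u, ..., a x + s u + r - 1, and
    the copy of H the colors a x + c, so only the numbers s u and the colors c at
    u have to fit together. *)
Lemma layered_colorable (G H : sgraph) (c : H -> H -> nat) (s b : H -> nat) r q t T :
  colorable G r t ->
  (forall u w, adj u w -> c u w = c w u) ->
  (forall u, perm_eq (iota (s u) r ++ palette c u) (iota (b u) (r + q))) ->
  covers b (r + q) T ->
  colorable (cart_prod G H) (r + q) (t + T - r).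
Proof.
move=> [f [a [fC palf cova]]] cC palc covb.
pose g u x y := s u + f x y; pose h x u w := a x + c u w.
apply: (cart_colorable (g := g) (h := h) _ _ _ (covers_add cova covb)).
- by move=> u x y /fC; rewrite /g => ->.
- by move=> x u w /cC; rewrite /h => ->.
move=> x u; rewrite !palette_shift /= iotaDl.
apply: perm_trans (perm_map _ (palc u)); rewrite map_cat -iotaDl perm_cat2r.
by rewrite addnC iotaDl perm_map.
Qed.

(** Let u0 be a vertex of H with an edge of color 0. Put the copy of G at u0 in
    the r colors below those of H, and the copy at every other u above those of
    H. As q < tH, a vertex of H which sees the
    largest color is not u0, so r extra colors are gained both at the bottom and
    at the top of the coloring of H. The picture at a fixed x thus takes tH + 2r
    colors, and its translates by a x, the largest of which is tG - r, take
    tG + tH + r. *)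
Lemma cart_colorable_add (G H : sgraph) r q tG tH :
  colorable G r tG -> colorable H q tH -> q < tH ->
  colorable (cart_prod G H) (r + q) (tG + tH + r).
Proof.
move=> colG [f [b [fC palf [[u0 bu0] bt_le cov]]]] qt.
pose s u := if u == u0 then 0 else r + b u + q.
pose b' u := if u == u0 then 0 else r + b u.
have -> : tG + tH + r = tG + (tH + r.*2) - r by lia.
apply: (layered_colorable (c := fun u w => r + f u w) (s := s) (b := b')) => //.
- by move=> u w /fC->.
- move=> u; rewrite palette_shift /s /b'; case: eqP => [-> | _].
    by rewrite iotaD perm_cat2l add0n -[X in iota X q]addn0 iotaDl perm_map -?bu0.
  rewrite perm_catC [r + q]addnC iotaD perm_cat2r iotaDl.
  exact: perm_map.
split; first by exists u0; rewrite /b' eqxx.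
  by move=> u; rewrite /b'; case: ifP => _; have := bt_le u; lia.
move=> i it; case: (ltnP i (r + q)) => [irq|irq].
  by exists u0; rewrite /b' eqxx.
case: (ltnP i (r + tH)) => [irt|irt].
  have /cov[u bu] : i - r < tH by lia.
  by exists u; rewrite /b'; case: eqP bu => [->|_]; rewrite ?bu0; lia.
have /cov[u bu] : tH.-1 < tH by lia.
have := bt_le u; exists u; rewrite /b'.
by case: eqP bu => [->|_]; rewrite ?bu0; lia.
Qed.

(** * Products with cycles *)

(** The edge from u to its successor has color [e u]. *)
Definition cycle_color (l : nat) (e : nat -> nat) (u w : cycle_graph l) : nat :=
  if ordS u == w then e u else e w.

Lemma ordSS_neq l (u : 'I_l) : 2 < l -> ordS (ordS u) != u.
Proof.
move=> l2; rewrite -val_eqE /=; have ul0 := ltn_ord u.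
case: (ltnP u.+1 l) => ul; last first.
  have E : u.+1 = l by lia.
  by rewrite E modnn modn_small; lia.
rewrite (modn_small ul); case: (ltnP u.+2 l) => ul'; first by rewrite modn_small; lia.
have E : u.+2 = l by lia.
by rewrite E modnn; lia.
Qed.

Lemma cycle_adjE l (u w : 'I_l) : 2 < l ->
  @adj (cycle_graph l) u w = (w == ordS u) || (u == ordS w).
Proof.
move=> l2; rewrite /= /cycle_adj -!val_eqE /= ![_ %% l == _]eq_sym.
case: eqP => //= ->; have wl := ltn_ord w; rewrite orbb; apply/esym/negbTE/eqP.
case: (ltnP w.+1 l) => wl1; first by rewrite modn_small; lia.
have E : w.+1 = l by lia.
by rewrite E modnn; lia.
Qed.

Lemma cycle_colorC l e (u w : cycle_graph l) : 2 < l -> adj u w ->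
  cycle_color e u w = cycle_color e w u.
Proof.
move=> l2; rewrite cycle_adjE // /cycle_color => /orP[] /eqP->.
  by rewrite eqxx (negbTE (ordSS_neq _ l2)).
by rewrite eqxx (negbTE (ordSS_neq _ l2)).
Qed.

Lemma palette_cycle l e (u : cycle_graph l) : 2 < l ->
  perm_eq (palette (cycle_color e) u) [:: e u; e (ord_pred u)].
Proof.
move=> l2.
have pred_succ : (ordS u == ord_pred u) = false.
  apply/negbTE; rewrite -(inj_eq (can_inj (@ordSK l)) (ordS u)) ord_predK.
  exact: ordSS_neq.
have -> : [:: e u; e (ord_pred u)]
    = [seq cycle_color e u w | w <- [:: ordS u; ord_pred u]].
  by rewrite /= /cycle_color eqxx pred_succ.
apply: perm_palette; first by rewrite /= inE pred_succ.
move=> w; rewrite -[RHS]/(adj u w) cycle_adjE // !inE; congr (_ || _).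
by rewrite -(inj_eq (can_inj (@ordSK l)) w) ord_predK eq_sym.
Qed.

Lemma val_ord_pred l (u : 'I_l) :
  ord_pred u = (if u == 0 :> nat then l.-1 else u.-1) :> nat.
Proof.
have ul := ltn_ord u; rewrite /=; case: eqP => [->|u0].
  by rewrite add0n modn_small; lia.
have -> : (u + l).-1 = u.-1 + l by lia.
by rewrite modnDr modn_small; lia.
Qed.

(** The last four hypotheses place two distinct numbers in the interval of
    length r + 2 outside the block of length r, whose complement has exactly two
    elements. *)
Lemma perm_iota_add2 s r x y b :
  b <= s <= b.+2 -> x != y -> b <= x < b + (r + 2) -> b <= y < b + (r + 2) ->
  ~~ (s <= x < s + r) -> ~~ (s <= y < s + r) ->
  perm_eq (iota s r ++ [:: x; y]) (iota b (r + 2)).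
Proof.
move=> bs xy bx by_ sx sy; apply: uniq_perm; last first.
- by move=> i; rewrite mem_cat !mem_iota !inE; lia.
- exact: iota_uniq.
by rewrite cat_uniq iota_uniq /= !inE !mem_iota; lia.
Qed.

(** Shift the copy of G at position j by j (r + 1) for j < n, and by
    (2n - j) (r + 1) + 1 for j >= n. The edge joining two consecutive copies
    gets a color between their blocks. The halves differ by one color so that
    the two edges at position 0, and those at position n, get distinct colors. *)
Lemma even_cycle_colorable (G : sgraph) r t n :
  2 <= n -> colorable G r t ->
  colorable (cart_prod G (cycle_graph (2 * n))) (r + 2) (t + n * r.+1 + 1).
Proof.
move=> n2 colG; pose T := n * r.+1 + r.+1.
have -> : t + n * r.+1 + 1 = t + T - r by rewrite /T; lia.
pose e j := if j < n then j * r.+1 + r else (2 * n - j.+1) * r.+1 + r.+1.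
pose s j := if j < n then j * r.+1 else (2 * n - j) * r.+1 + 1.
pose b j := if j <= n then (j * r.+1).-1 else (2 * n - j) * r.+1.
have l2 : 2 < 2 * n by lia.
apply: (layered_colorable (c := cycle_color e) (s := fun u => s u)
  (b := fun u => b u)) => //.
- by move=> u w uw; apply: cycle_colorC.
- move=> u; have ul := ltn_ord u.
  apply: (perm_trans (y := iota (s u) r ++ [:: e u; e (ord_pred u)])).
    by rewrite perm_cat2l; apply: palette_cycle.
  rewrite val_ord_pred /s /e /b; case: (ltngtP u n) => [un|nu|->].
  + case: eqP => [->|u0].
      have -> : ((2 * n).-1 < n) = false by lia.
      have -> : 2 * n - (2 * n).-1.+1 = 0 by lia.
      by apply: perm_iota_add2; lia.
    have -> : (u.-1 < n) = true by lia.
    have [j uj] : exists j, nat_of_ord u = j.+1 by exists u.-1; lia.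
    by rewrite uj; apply: perm_iota_add2; lia.
  + have -> : (u == 0 :> nat) = false by lia.
    have -> : (u.-1 < n) = false by lia.
    have [j uj] : exists j, 2 * n - u = j.+1 by exists (2 * n - u.+1); lia.
    have -> : 2 * n - u.+1 = j by lia.
    have -> : 2 * n - u.-1.+1 = j.+1 by lia.
    by rewrite uj; apply: perm_iota_add2; lia.
  have -> : (n == 0) = false by lia.
  have -> : (n.-1 < n) = true by lia.
  have -> : 2 * n - n.+1 = n.-1 by lia.
  have -> : 2 * n - n = n by lia.
  have [j nj] : exists j, n = j.+1 by exists n.-1; lia.
  by rewrite nj; apply: perm_iota_add2; lia.
split.
- have l0 : 0 < 2 * n by lia.
  by exists (Ordinal l0).
- move=> u; have ul := ltn_ord u; rewrite /b /T; case: ifP => un.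
    by have := leq_mul un (leqnn r.+1); lia.
  have un' : (2 * n - u).+1 <= n by lia.
  by have := leq_mul un' (leqnn r.+1); lia.
(* The first half of the cycle suffices: at j its smallest color is
   j (r + 1) - 1, or 0 for j = 0. The minimum with n is needed for the largest
   color only, where i + 1 = (n + 1) (r + 1). *)
move=> i iT; pose j := minn n (i.+1 %/ r.+1).
have jl : j < 2 * n by lia.
exists (Ordinal jl); rewrite /b /= /j geq_minl.
have := divn_eq i.+1 r.+1; have := ltn_mod i.+1 r.+1.
move: (i.+1 %/ r.+1) (i.+1 %% r.+1) => d m /= mr Ei; rewrite /T in iT.
case: (leqP d n) => dn.
  by lia.
have := leq_mul dn (leqnn r.+1).
lia.
Qed.

(** The color h completes the colors p to an interval. After a shift by s, one
    more color z just above (first case) or just below (second case) extends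
    it. *)
Lemma perm_fill_hole p h a r s b z :
  perm_eq (p ++ [:: h]) (iota a r.+1) ->
  (z = s + r.+1 /\ b = s) \/ (z.+1 = s /\ b = z) ->
  perm_eq ([seq s + i | i <- p] ++ [:: s + h; a + z]) (iota (a + b) r.+2).
Proof.
move=> /(perm_map (addn s)); rewrite map_cat -iotaDl.
rewrite -[[:: _; a + z]]/([:: _] ++ [:: a + z]) catA => ph [[-> ->]|[zs ->]].
  have -> : r.+2 = r.+1 + 1 by lia.
  by rewrite iotaD addnA [a + s]addnC perm_cat2r.
rewrite -zs in ph *; rewrite perm_catC perm_cons; have -> : (a + z).+1 = z.+1 + a by lia.
exact: ph.
Qed.

(** The distance of the pair 2p, 2p + 1 containing j from the pair 0, 1, along
    the cycle of n pairs. It is also correct for j = 2n, the position after the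
    last one. *)
Definition pair_level n j := minn j./2 (n - j./2).

(** The coloring of G leaves room for one more color, [rung x], at every vertex
    x. The copies 2p and 2p + 1 of G are joined by edges with these colors and
    have the same shift, r + 2 times the level of the pair. An edge between two
    pairs takes the color just above the lower one, which is also just below the
    upper one if their levels differ. For odd n the two pairs at the top have
    the same level, and the edges between them use one more color. *)
Lemma paired_cycle_colorable (G : sgraph) (f : G -> G -> nat) (rung a : G -> nat) r t n :
  2 <= n ->
  (forall x y, adj x y -> f x y = f y x) ->
  (forall x, perm_eq (palette f x ++ [:: rung x]) (iota (a x) r.+1)) ->
  covers a r.+1 t ->
  colorable (cart_prod G (cycle_graph (2 * n))) (r + 2) (t + n./2 * (r + 2) + odd n).
Proof.
move=> n2 fC palf cova; pose T := n./2 * (r + 2) + odd n + r.+1.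
have -> : t + n./2 * (r + 2) + odd n = t + T - r.+1 by rewrite /T; lia.
have -> : r + 2 = r.+1 + 1 by lia.
have l2 : 2 < 2 * n by lia.
pose s j := pair_level n j * r.+2.
(* Whether the edges from j to the adjacent pair have colors above the block of
   copy j: for j odd the adjacent pair follows j, for j even it precedes j. *)
pose above j := if odd j then j <= n else (j == 0) || (n < j).
pose b j := if above j then s j else (s j).-1.
pose z j := if above j then s j + r.+1 else (s j).-1.
pose e x j := if odd j then a x + (minn (s j) (s j.+1) + r.+1) else s j + rung x.
have s0 j : ~~ above j -> 0 < j < 2 * n -> 0 < s j.
  move=> aj j0; rewrite muln_gt0 andbT /pair_level; move: aj.
  by rewrite /above; case: ifP; lia.
apply: (cart_colorable (g := fun (u : cycle_graph (2 * n)) x y => s u + f x y)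
  (h := fun x => cycle_color (e x))
  (a := fun p : G * cycle_graph (2 * n) => a p.1 + b p.2)).
- by move=> u x y /fC->.
- by move=> x u w; apply: cycle_colorC.
- move=> x u; have ul := ltn_ord u; rewrite palette_shift.
  have -> : r.+1 + 1 = r.+2 by lia.
  apply: (@perm_trans _ ([seq s u + i | i <- palette f x]
                         ++ [:: s u + rung x; a x + z u])); last first.
    apply: perm_fill_hole (palf x) _.
    rewrite /z /b; case: ifPn => [_|ab]; first by left.
    right; split=> //; rewrite prednK // s0 //.
    by move: ab; rewrite /above; case: (odd u) => //=; lia.
  rewrite perm_cat2l; apply: perm_trans (palette_cycle _ _ l2) _.
  rewrite val_ord_pred /e; case: (boolP (odd u)) => ou.
    have -> : (u == 0 :> nat) = false by lia.
    have -> : odd u.-1 = false by lia.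
    have -> : s u.-1 = s u.
      by rewrite /s /pair_level; have -> : (u.-1)./2 = u./2 by lia.
    have -> : minn (s u) (s u.+1) + r.+1 = z u.
      rewrite /z /above ou /s -minnMl; case: ifP => un.
        have -> : minn (pair_level n u) (pair_level n u.+1) = pair_level n u => //.
        by rewrite /pair_level; lia.
      have -> : minn (pair_level n u) (pair_level n u.+1) = (pair_level n u).-1.
        by rewrite /pair_level; lia.
      have : 0 < pair_level n u by rewrite /pair_level; lia.
      by case: (pair_level n u) => // q _; lia.
    by rewrite -[[:: a x + _; _]]/([:: _] ++ [:: _]) perm_catC.
  rewrite perm_cons; case: eqP => [-> | u0].
    have -> : odd (2 * n).-1 by lia.
    have -> : z 0 = r.+1 by rewrite /z /above /s /pair_level min0n.
    have -> : s (2 * n).-1.+1 = 0.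
      have lev0 : pair_level n (2 * n).-1.+1 = 0 by rewrite /pair_level; lia.
      by rewrite /s lev0.
    by rewrite minn0.
  have -> : odd u.-1 by lia.
  have -> : u.-1.+1 = u by lia.
  suff -> : minn (s u.-1) (s u) + r.+1 = z u by [].
  rewrite /z /above (negbTE ou) /s -minnMl; case: ifP => un.
    have -> : minn (pair_level n u.-1) (pair_level n u) = pair_level n u => //.
    by rewrite /pair_level; lia.
  have -> : minn (pair_level n u.-1) (pair_level n u) = (pair_level n u).-1.
    by rewrite /pair_level; lia.
  have : 0 < pair_level n u by rewrite /pair_level; lia.
  by case: (pair_level n u) => // q _; lia.
apply: (covers_add (b := fun u : cycle_graph (2 * n) => b u) cova); split.
- have l0 : 0 < 2 * n by lia.
  by exists (Ordinal l0); rewrite /b /s /pair_level /= min0n mul0n.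
- move=> u; have ul := ltn_ord u; rewrite /b /T.
  have lev : pair_level n u <= n./2 by rewrite /pair_level; lia.
  have := leq_mul lev (leqnn r.+2); rewrite -/(s u); case: ifPn => [|/s0]; last by lia.
  rewrite /above; case: ifP => ou un su.
    case: (boolP (odd n)) => on; first by lia.
    have lev' : (pair_level n u).+1 <= n./2 by rewrite /pair_level; lia.
    by have := leq_mul lev' (leqnn r.+2); rewrite /s; lia.
  case/orP: un => un.
    by rewrite (eqP un) /s /pair_level min0n mul0n; lia.
  case: (boolP (odd n)) => on; first by lia.
  have lev' : (pair_level n u).+1 <= n./2 by rewrite /pair_level; lia.
  by have := leq_mul lev' (leqnn r.+2); rewrite /s; lia.
move=> i; rewrite /T => iT.
have := divn_eq i r.+2; have := ltn_mod i r.+2.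
move: (i %/ r.+2) (i %% r.+2) => d q /= qr Ei.
have dn : d <= n./2.
  case: leqP => // dn; have := leq_mul dn (leqnn r.+2); lia.
(* The edges from copy 2d + 1 to the next pair have larger colors than its
   block, unless n = 2d, where the pair is alone at the top. *)
pose j := if d.*2.+1 <= n then d.*2.+1 else d.*2.
have jl : j < 2 * n by rewrite /j; case: ifP; lia.
have lj : pair_level n j = d by rewrite /pair_level /j; case: ifP; lia.
exists (Ordinal jl); rewrite /b /s /= lj.
case: (ltnP d.*2 n) => dn2.
  by rewrite /above /j dn2 /= odd_double dn2 /=; lia.
have nd : n = d.*2 by lia.
by rewrite nd odd_double doubleK in iT; case: ifP; lia.
Qed.

(** The labels 1, 3, ..., 2m + 1, 2m, ..., 4, 2 rise by 2 and descend by 2, with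
    steps of 1 at the turning points 0 and m + 1. Hence the missing color of a
    vertex lies between its two labels, except at 0 and m + 1, where the colors
    0 and 2m + 2 are chosen so as to enlarge the range. *)
Lemma odd_even_cycles_colorable m n : 1 <= m -> 2 <= n ->
  colorable (cart_prod (cycle_graph (2 * m + 1)) (cycle_graph (2 * n))) 4
    (2 * m + 3 + n./2 * 4 + odd n).
Proof.
move=> m1 n2; have l2 : 2 < 2 * m + 1 by lia.
pose e j := if j <= m then j.*2.+1 else (2 * m + 1 - j).*2.
pose a j := if j <= m then j.*2.-1 else (2 * m + 1 - j).*2.
pose rung j := if j <= m then j.*2 else (2 * m + 1 - j).*2.+1 + (j == m.+1).
apply: (@paired_cycle_colorable _ (cycle_color e) (fun u => rung u)
  (fun u => a u) 2 _ _ n2).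
- by move=> u w; apply: cycle_colorC.
- move=> u; have ul := ltn_ord u; rewrite perm_catC.
  apply: (@perm_trans _ (iota (rung u) 1 ++ [:: e u; e (ord_pred u)])).
    by rewrite perm_cat2l; apply: palette_cycle.
  rewrite val_ord_pred /a /rung /e; case: (leqP u m) => um.
    have [u0|u0] := eqVneq (nat_of_ord u) 0; last first.
      have -> : u.-1 <= m by lia.
      by apply: perm_iota_add2; lia.
    have -> : ((2 * m + 1).-1 <= m) = false by lia.
    by apply: perm_iota_add2; lia.
  have -> : (u == 0 :> nat) = false by lia.
  case: eqP => um1; first by rewrite um1 leqnn; apply: perm_iota_add2; lia.
  have -> : (u.-1 <= m) = false by lia.
  by apply: perm_iota_add2; lia.
have l0 : 0 < 2 * m + 1 by lia.
split.
- by exists (Ordinal l0).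
- by move=> u; have ul := ltn_ord u; rewrite /a; case: ifP; lia.
move=> i it; pose k := minn i (2 * m).
pose j := if odd k then k.+1./2 else if k == 0 then 0 else 2 * m + 1 - k./2.
have kM : k <= 2 * m by lia.
have jl : j < 2 * m + 1.
  rewrite /j; case: (boolP (odd k)) => ok; first by lia.
  by have [k0|k0] := eqVneq k 0; lia.
exists (Ordinal jl); rewrite /= (_ : a j = k); first by rewrite /k; lia.
rewrite /a /j; case: (boolP (odd k)) => ok; first by case: ifP; lia.
have [->//|k0] := eqVneq k 0.
by case: ifP; lia.
Qed.

(** * Lower bounds for tori *)

(** In contrast to a bound on W, this keeps an interval coloring of the product
    available for further factors. *)
Definition wide_colorable (ls : seq nat) (N : nat) : Prop :=
  exists2 t, N <= t & colorable (cycle_product ls) (2 * size ls) t.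

Lemma wide_leq ls N N' : N' <= N -> wide_colorable ls N -> wide_colorable ls N'.
Proof. by move=> NN' [t Nt colt]; exists t => //; apply: leq_trans Nt. Qed.

Lemma wide_perm ls ls' N :
  perm_eq ls ls' -> wide_colorable ls N -> wide_colorable ls' N.
Proof.
move=> E [t Nt colt]; exists t => //; rewrite -(perm_size E).
exact: graph_iso_colorable (cycle_product_perm E) colt.
Qed.

Lemma wide_nil : wide_colorable [::] 0.
Proof.
exists 0 => //; exists (fun _ _ => 0), (fun _ => 0); split=> //.
  by move=> v; rewrite /palette; have -> : enum (adj v) = [::] by apply: enum0.
Qed.

Lemma wide_even ls N n : 2 <= n -> wide_colorable ls N ->
  wide_colorable (rcons ls (2 * n)) (N + 1 + n * (2 * size ls + 1)).
Proof.
move=> n2 [t Nt colt]; exists (t + n * (2 * size ls).+1 + 1); first by lia.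
rewrite cycle_product_rcons size_rcons.
have -> : 2 * (size ls).+1 = 2 * size ls + 2 by lia.
exact: even_cycle_colorable.
Qed.

Lemma wide_cat ls ls' N N' : 2 * size ls' < N' ->
  wide_colorable ls N -> wide_colorable ls' N' ->
  wide_colorable (ls ++ ls') (N + N' + 2 * size ls).
Proof.
move=> lsN' [t Nt colt] [t' Nt' colt']; exists (t + t' + 2 * size ls); first by lia.
rewrite size_cat mulnDr.
apply: graph_iso_colorable (graph_iso_sym (cycle_product_cat _ _)) _.
by apply: cart_colorable_add => //; lia.
Qed.

Lemma wide_even_odd m n : 1 <= m -> 2 <= n ->
  wide_colorable [:: 2 * n; 2 * m + 1] (2 * (m + n) + 2).
Proof.
move=> m1 n2; apply: (@wide_perm [:: 2 * m + 1; 2 * n]).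
  by rewrite -[[:: _; 2 * n]]/([:: _] ++ [:: _]) perm_catC.
exists (2 * m + 3 + n./2 * 4 + odd n); first by lia.
apply: graph_iso_colorable (odd_even_cycles_colorable m1 n2).
by apply: graph_iso_cart; [apply: cycle_product1 | apply: graph_iso_refl].
Qed.

Lemma wide_le_W ls N : wide_colorable ls N -> N <= W (torus ls).
Proof.
move=> [[|t] Nt colt]; first by lia.
by apply: leq_trans Nt (colorable_le_W _ (graph_iso_colorable (torus_iso ls) colt)).
Qed.

Lemma nondecreasing_ge n k c : c <= n 1 ->
  (forall i, 1 <= i < k -> n i <= n i.+1) -> forall i, 1 <= i <= k -> c <= n i.
Proof.
move=> n1 ninc; elim=> [|[|i] IH] //= ik; apply: leq_trans (ninc _ _); last by lia.
by apply: IH; lia.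
Qed.

Lemma iota1_rcons k : iota 1 k.+1 = rcons (iota 1 k) k.+1.
Proof. by rewrite -{1}[k.+1]addn1 iotaD cats1. Qed.

(** The j-th even cycle is added to a graph of degree 2 (size ls + j - 1). *)
Lemma wide_evens ls N n s :
  (forall j, 1 <= j <= s -> 2 <= n j) -> wide_colorable ls N ->
  wide_colorable (ls ++ [seq 2 * n j | j <- iota 1 s])
    (s + N + \sum_(1 <= j < s.+1) n j * (2 * size ls + 2 * j - 1)).
Proof.
move=> n2 wls; elim: s n2 => [|s IH] n2.
  by rewrite big_geq //= cats0 add0n addn0.
rewrite iota1_rcons map_rcons -rcons_cat big_nat_recr //=.
have n2' j : 1 <= j <= s -> 2 <= n j by move=> js; apply: n2; lia.
have ns2 : 2 <= n s.+1 by apply: n2; lia.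
apply: wide_leq (wide_even ns2 (IH n2')); rewrite size_cat size_map size_iota.
have -> : 2 * size ls + 2 * s.+1 - 1 = 2 * (size ls + s) + 1 by lia.
by lia.
Qed.

(** The term 2 k^2 is 2 k + 4 (0 + 1 + ... + (k - 1)): each pair of cycles
    contributes 2, and 4 (i - 1) is the degree of the product of the first i - 1
    pairs. *)
Lemma wide_pairs k m n :
  (forall i, 1 <= i <= k -> 1 <= m i) -> (forall i, 1 <= i <= k -> 2 <= n i) ->
  wide_colorable
    ([seq 2 * n i | i <- iota 1 k] ++ [seq 2 * m i + 1 | i <- iota 1 k])
    (2 * k ^ 2 + 2 * (\sum_(1 <= i < k.+1) (m i + n i))).
Proof.
elim: k => [|k IH] m1 n2; first by rewrite big_geq //=; exact: wide_nil.
rewrite iota1_rcons !map_rcons big_nat_recr //=.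
have wk : wide_colorable [:: 2 * n k.+1; 2 * m k.+1 + 1] (2 * (m k.+1 + n k.+1) + 2).
  by apply: wide_even_odd; [apply: m1 | apply: n2]; lia.
have {}IH : wide_colorable
    ([seq 2 * n i | i <- iota 1 k] ++ [seq 2 * m i + 1 | i <- iota 1 k])
    (2 * k ^ 2 + 2 * (\sum_(1 <= i < k.+1) (m i + n i))).
  by apply: IH => i ik; [apply: m1 | apply: n2]; lia.
have size_lt : 2 * size [:: 2 * n k.+1; 2 * m k.+1 + 1] < 2 * (m k.+1 + n k.+1) + 2.
  by have := n2 k.+1; rewrite /=; lia.
have := wide_cat size_lt IH wk; rewrite size_cat !size_map size_iota => W'.
apply: wide_perm (wide_leq _ W'); last by rewrite !expnS expn0; lia.
by apply/permP => p; rewrite -!cats1 !count_cat /=; lia.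
Qed.

Theorem theorem6p1 :
  (forall (k : nat) (n : nat -> nat),
     1 <= k ->
     2 <= n 1 ->
     (forall i, 1 <= i < k -> n i <= n i.+1) ->
     k + \sum_(1 <= i < k.+1) n i * (2 * i - 1)
       <= W (torus [seq 2 * n i | i <- iota 1 k]))
  /\
  (forall (k s : nat) (m n : nat -> nat),
     1 <= k ->
     1 <= m 1 ->
     (forall i, 1 <= i < k -> m i <= m i.+1) ->
     2 <= n 1 ->
     (forall i, 1 <= i < k + s -> n i <= n i.+1) ->
     s + 2 * k ^ 2 + 2 * (\sum_(1 <= i < k.+1) (m i + n i))
       + \sum_(1 <= j < s.+1) n (k + j) * (4 * k + 2 * j - 1)
       <= W (torus ([seq 2 * n i | i <- iota 1 (k + s)]
                    ++ [seq 2 * m i + 1 | i <- iota 1 k]))).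
Proof.
split=> [k n _ n1 ninc | k s m n _ m1 minc n1 ninc].
  apply: wide_le_W; have := wide_evens (nondecreasing_ge n1 ninc) wide_nil.
  by rewrite /= muln0 addn0.
have m_ge := nondecreasing_ge m1 minc; have n_ge := nondecreasing_ge n1 ninc.
have wp : wide_colorable
    ([seq 2 * n i | i <- iota 1 k] ++ [seq 2 * m i + 1 | i <- iota 1 k])
    (2 * k ^ 2 + 2 * (\sum_(1 <= i < k.+1) (m i + n i))).
  by apply: wide_pairs => // i ik; apply: n_ge; lia.
apply: wide_le_W.
have nks j : 1 <= j <= s -> 2 <= n (k + j) by move=> js; apply: n_ge; lia.
have := wide_evens nks wp; rewrite size_cat !size_map size_iota.
have -> : 2 * (k + k) = 4 * k by lia.
move=> W'; apply: (wide_perm _ (wide_leq _ W')); last by lia.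
rewrite iotaD map_cat -!catA perm_cat2l perm_catC.
rewrite addnC iotaDl -map_comp perm_cat2r; exact: perm_refl.
Qed.
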